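(* Let $n\ge1$ be an integer, $T>0$, and $L=\dfrac{1}{K_nT^n}$. Then there exists a measurable function $\tau:[0,T]\to[0,T]$ such that the periodic boundary value problem $$x^{(n)}(t)=L\,x(\tau(t)),\quad t\in[0,T],\qquad x^{(i)}(0)=x^{(i)}(T),\quad i=0,\ldots,n-1,$$ has a non-constant solution $x\in\mathbf{AC}^{n-1}([0,T],\mathbb{R})$.
   Context: The constants $K_n$, $n=1,2,\ldots$, are defined by $$K_n=\frac{(2^{n+1}-1)|B_{n+1}|}{2^{n-1}(n+1)!}\ \text{ if } n \text{ is odd},\qquad K_n=\frac{|E_n|}{4^n n!}\ \text{ if } n\text{ is even},$$ where $B_k$ are the Bernoulli numbers ($\frac{t}{e^t-1}=\sum_{k\ge0}B_k\frac{t^k}{k!}$) and $E_k$ are the Euler numbers ($\frac{1}{\cosh t}=\sum_{k\ge0}E_k\frac{t^k}{k!}$). $\mathbf{AC}^{n-1}([0,T],\mathbb{R})$ is the space of functions $[0,T]\to\mathbb{R}$ with absolutely continuous derivatives up to order $n-1$. Differential equations are understood to hold for almost all $t\in[0,T]$. *)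

(* Defs.v *)
From HB Require Import structures.
From mathcomp Require Import all_boot all_order all_algebra.
From mathcomp Require Import ring lra.
From mathcomp Require Import all_classical all_reals all_analysis.

Set Implicit Arguments.
Unset Strict Implicit.
Unset Printing Implicit Defensive.

Import Order.TTheory GRing.Theory Num.Theory.
Import numFieldNormedType.Exports.

Local Open Scope classical_set_scope.
Local Open Scope ring_scope.

Section bernoulli_euler.
Variable R : realType.
Implicit Types (c B E : nat -> R) (g : R -> R) (t : R).

(* [g t = \sum_k c k t^k / k!] for all [t != 0] close to 0. The point 0 is left
   out because [t / (expR t - 1)] is the junk value 0 there. *)
Definition is_egf c g : Prop :=
  \forall t \near 0^', pseries (fun k => c k / k`!%:R) t @ \oo --> g t.

Definition cosh t : R := (expR t + expR (- t)) / 2.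

Definition bernoulli_numbers B : Prop := is_egf B (fun t => t / (expR t - 1)).

Definition euler_numbers E : Prop := is_egf E (fun t => (cosh t)^-1).

(* A convergent power series determines its coefficients, so these choices are
   unique; existence is [bernoulli_numbersP] and [euler_numbersP] below. *)
Definition bernoulli_nb : nat -> R := xget (fun=> 0) [set B | bernoulli_numbers B].

Definition euler_nb : nat -> R := xget (fun=> 0) [set E | euler_numbers E].

Definition favardK (n : nat) : R :=
  if odd n then (2 ^+ n.+1 - 1) * `|bernoulli_nb n.+1| / (2 ^+ n.-1 * n.+1`!%:R)
  else `|euler_nb n| / (4 ^+ n * n`!%:R).

End bernoulli_euler.

Section abs_continuous_derivatives.
Variables (R : realType) (a b : R).
Implicit Types (f x : R -> R) (t : R).

Definition abs_continuous_on f : Prop :=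
  forall e : R, 0 < e -> exists2 d : R, 0 < d &
  forall (m : nat) (u v : 'I_m -> R),
    (forall i, a <= u i /\ u i <= v i /\ v i <= b) ->
    trivIset [set: 'I_m] (fun i => `]u i, v i[%classic) ->
    \sum_(i < m) (v i - u i) < d ->
    \sum_(i < m) `|f (v i) - f (u i)| < e.

(* Difference quotients use only points of [a, b]: the derivative is one-sided
   at [a] and at [b], and values of [f] outside [a, b] play no role. *)
Definition diff_quot_on f t : set_system R :=
  (f s - f t) / (s - t) @[s --> within `[a, b]%classic t^'].

Definition derivable_on f t : Prop := cvg (diff_quot_on f t).

Definition deriv_on f t : R := lim (diff_quot_on f t).

Definition derivn_on (k : nat) f : R -> R := iter k deriv_on f.

(* Members of AC^m([a, b], R), represented by functions on the whole line. *)
Definition AC_on (m : nat) x : Prop :=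
  (forall k t, (k < m)%N -> a <= t <= b -> derivable_on (derivn_on k x) t) /\
  (forall k, (k <= m)%N -> abs_continuous_on (derivn_on k x)).

End abs_continuous_derivatives.

Section existence.
Variable R : realType.

Section reciprocal.
Variable a : nat -> R.
Hypothesis a0 : a 0%N = 1.
Hypothesis a1 : forall N, \sum_(i < N) `|a i.+1| <= 1.

Fixpoint rcp_seq (n : nat) : seq R :=
  if n is m.+1 then
    rcons (rcp_seq m)
      ((m == 0%N)%:R - \sum_(j < m) (rcp_seq m)`_j * a (m - j))
  else [::].

Let c k := (rcp_seq k.+1)`_k.

Let size_rcp n : size (rcp_seq n) = n.
Proof. by elim: n => //= n IH; rewrite size_rcons IH. Qed.

Let nth_rcp n j : (j < n)%N -> (rcp_seq n)`_j = c j.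
Proof.
elim: n => // n IH; rewrite ltnS leq_eqVlt => /orP[/eqP -> //|jn] /=.
by rewrite nth_rcons size_rcp jn IH.
Qed.

Let cE k : c k = (k == 0%N)%:R - \sum_(j < k) c j * a (k - j).
Proof.
rewrite {1}/c /= nth_rcons size_rcp ltnn eqxx; congr (_ - _).
by apply: eq_bigr => j _; rewrite nth_rcp.
Qed.

Let c_conv k : \sum_(j < k.+1) c j * a (k - j) = (k == 0%N)%:R.
Proof. by rewrite big_ord_recr /= subnn a0 mulr1 cE addrC subrK. Qed.

Let c_le1 k : `|c k| <= 1.
Proof.
elim/ltn_ind: k => -[|k] IH.
  by rewrite cE big_ord0 subr0 normr1.
rewrite cE sub0r normrN (le_trans (ler_norm_sum _ _ _))//.
apply: le_trans (a1 k.+1).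
rewrite (reindex_inj rev_ord_inj) /=; apply: ler_sum => j _.
rewrite normrM subKn ?ltn_ord// -[leRHS]mul1r ler_wpM2r//.
by apply: IH; rewrite subSS ltnS leq_subr.
Qed.

Let conv_le2 N k :
  `|((\poly_(i < N) c i) * (\poly_(i < N) a i))`_k| <= 2.
Proof.
rewrite coefMr (le_trans (ler_norm_sum _ _ _))//.
apply: (@le_trans _ _ (\sum_(j < k.+1) `|a j|)).
  apply: ler_sum => j _; rewrite normrM !coef_poly.
  rewrite -[leRHS]mul1r; apply: ler_pM => //; case: ifP => // _.
  - by rewrite normr0.
  - by rewrite normr0.
rewrite big_ord_recl a0 normr1; have := a1 k.
rewrite (_ : 2 = 1 + 1) // lerD2l.
by apply: le_trans; apply: ler_sum.
Qed.

Let geo_tail N M : \sum_(i < M) 2 * 2^-1 ^+ (N + i) <= 4 * 2^-1 ^+ N :> R.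
Proof.
have -> : \sum_(i < M) 2 * 2^-1 ^+ (N + i)
   = 4 * 2^-1 ^+ N - 4 * 2^-1 ^+ (N + M) :> R.
  elim: M => [|M IH]; first by rewrite big_ord0 addn0 subrr.
  rewrite big_ord_recr /= IH addnS exprS; by field.
by rewrite lerBlDr lerDl mulr_ge0// exprn_ge0// invr_ge0.
Qed.

Let psE (f : nat -> R) t N : pseries f t N = (\poly_(i < N) f i).[t].
Proof. by rewrite horner_poly /pseries /series /= big_mkord. Qed.

Let prod_bound t N : `|t| <= 2^-1 -> (0 < N)%N ->
  `|pseries c t N * pseries a t N - 1| <= 4 * 2^-1 ^+ N.
Proof.
move=> ht N0; rewrite !psE -hornerM.
set p := _ * _.
have sp : (size p <= N + N)%N.
  rewrite (leq_trans (size_polyMleq _ _))// (leq_trans (leq_pred _))//.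
  by rewrite leq_add ?size_poly.
have pk k : (k < N)%N -> p`_k = (k == 0%N)%:R.
  move=> kN; rewrite /p coefM -[RHS](c_conv k); apply: eq_bigr => j _.
  have jk : (j <= k)%N by rewrite -ltnS.
  by rewrite !coef_poly (leq_ltn_trans jk)// (leq_ltn_trans (leq_subr _ _)).
rewrite (horner_coef_wide _ sp) big_split_ord /=.
rewrite (bigD1 (Ordinal N0))//= pk// mul1r expr0 big1 ?addr0; last first.
  move=> i i0.
  by rewrite pk// (_ : (i == 0%N :> nat) = false) ?mul0r//; apply: negbTE.
rewrite addrC addrK; apply: le_trans (geo_tail N N).
apply: (le_trans (ler_norm_sum _ _ _)); apply: ler_sum => i _.
rewrite normrM normrX; apply: ler_pM; rewrite ?exprn_ge0 ?normr_ge0//.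
  exact: conv_le2.
by rewrite lerXn2r// ?nnegrE.
Qed.

Lemma reciprocal_pseries t (A : R) : `|t| <= 2^-1 -> A != 0 ->
  pseries a t @ \oo --> A -> pseries c t @ \oo --> A^-1.
Proof.
move=> ht A0 aA.
have h1 : (fun N => pseries c t N * pseries a t N) @ \oo --> (1 : R).
  apply/subr_cvg0.
  have h0 : (fun N => 4 * 2^-1 ^+ N) @ \oo --> (0 : R).
    rewrite -[X in _ --> X](mulr0 4); apply: cvgMr; apply: cvg_expr.
    by rewrite ger0_norm// invf_lt1 ?ltr1n.
  apply/norm_cvg0P.
  apply: (@squeeze_cvgr _ _ _ _ (fun=> 0) (fun N => 4 * 2^-1 ^+ N)) => //.
    near=> N; rewrite normr_ge0 prod_bound//.
    by near: N; exists 1%N.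
  exact: cvg_cst.
have aN : \forall N \near \oo, pseries a t N != 0.
  exact: (@cvgr_neq0 R R^o _ _ _ _ _ aA A0).
rewrite -[A^-1]mul1r; apply: cvg_trans (cvgM h1 (cvgV A0 aA)).
apply: near_eq_cvg.
near=> N; rewrite /= -mulrA divff ?mulr1//.
by near: N.
Unshelve. all: by end_near. Qed.

End reciprocal.

Lemma is_egf_reciprocal (a : nat -> R) (g h : R -> R) :
  a 0%N = 1 -> (forall N, \sum_(i < N) `|a i.+1| <= 1) ->
  (\forall t \near 0^', [/\ h t != 0, pseries a t @ \oo --> h t
                          & g t = (h t)^-1]) ->
  exists c, is_egf c g.
Proof.
move=> a0 a1 ah; exists (fun k => (rcp_seq a k.+1)`_k * k`!%:R).
rewrite /is_egf; near=> t.
have [ht aht ->] : [/\ h t != 0, pseries a t @ \oo --> h t & g t = (h t)^-1].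
  by near: t.
rewrite (_ : (fun k => _) = (fun k => (rcp_seq a k.+1)`_k)); last first.
  apply/funext => k; rewrite mulfK// pnatr_eq0 -lt0n fact_gt0 //.
apply: reciprocal_pseries => //.
near: t; apply: nbhs_dnbhs; apply/nbhs_normP; exists 2^-1 => //=.
by move=> t; rewrite /= sub0r normrN => /ltW.
Unshelve. all: by end_near. Qed.

Lemma inv_fact_sum N : \sum_(i < N) (i.+2`!%:R^-1 : R) <= 1 - N.+1`!%:R^-1.
Proof.
elim: N => [|N IH]; first by rewrite big_ord0 invr1 subrr.
rewrite big_ord_recr /=.
have : (N.+2`!%:R^-1 : R) *+ 2 <= N.+1`!%:R^-1.
  rewrite factS natrM invfM -mulrnAl -[leRHS]mul1r ler_wpM2r ?invr_ge0//.
  have : (N.+2%:R^-1 : R) <= 2^-1 by rewrite lef_pV2 ?posrE ?ltr0n// ler_nat.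
  by move: (N.+2%:R^-1) => y hy; rewrite -mulr_natr -ler_pdivlMr// mul1r.
by move: IH; rewrite mulr2n; lra.
Qed.

Lemma inv_fact_sum1 N : \sum_(i < N) (i.+2`!%:R^-1 : R) <= 1.
Proof. by rewrite (le_trans (inv_fact_sum _))// gerBl invr_ge0. Qed.

Lemma bernoulli_numbersP : bernoulli_numbers (@bernoulli_nb R).
Proof.
have [B hB] : exists B : nat -> R, bernoulli_numbers B.
  apply: (@is_egf_reciprocal (fun i => i.+1`!%:R^-1) _
    (fun t => (expR t - 1) / t)).
  - by rewrite invr1.
  - move=> N; apply: le_trans (inv_fact_sum1 N); apply: ler_sum => i _.
    by rewrite ger0_norm ?invr_ge0.
  near=> t; have t0 : t != 0 by near: t; exact: nbhs_dnbhs_neq.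
  split.
  - by rewrite mulf_neq0 ?invr_eq0// subr_eq0 -expR0 (inj_eq (@expR_inj R)).
  - rewrite (_ : pseries _ t = fun N => (series (exp_coeff t) N.+1 - 1) / t).
      apply: cvgMl; apply: cvgB; last exact: cvg_cst.
      by rewrite (cvg_shiftS (series (exp_coeff t))); exact: is_cvg_series_exp_coeff.
    apply/funext => N; rewrite /pseries /series /= big_nat_recl//.
    rewrite exp_coeffE /= expr0 fact0 invr1 mulr1 [1 + _]addrC addrK mulr_suml.
    by apply: eq_bigr => i _; rewrite exprSr mulrA mulfK.
  - by rewrite invf_div.
by rewrite /bernoulli_nb; case: xgetP => [? -> //|/(_ B)].
Unshelve. all: by end_near. Qed.

Lemma euler_numbersP : euler_numbers (@euler_nb R).
Proof.
have [E hE] : exists E : nat -> R, euler_numbers E.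
  apply: (@is_egf_reciprocal (fun i => (~~ odd i)%:R / i`!%:R) _ (@cosh R)).
  - by rewrite fact0 divr1.
  - case=> [|N]; first by rewrite big_ord0.
    rewrite big_ord_recl /= mul0r normr0 add0r.
    apply: le_trans (inv_fact_sum1 N); apply: ler_sum => i _.
    rewrite ger0_norm ?divr_ge0// ler_piMl// ?invr_ge0//.
    by case: (~~ _).
  near=> t; split => //.
  - by rewrite mulf_neq0 ?invr_eq0// gt_eqF// addr_gt0// expR_gt0.
  - rewrite (_ : pseries _ t = fun N =>
      (series (exp_coeff t) N + series (exp_coeff (- t)) N) / 2).
      by apply: cvgMl; apply: cvgD; exact: is_cvg_series_exp_coeff.
    apply/funext => N; rewrite /pseries /series /= -big_split /= mulr_suml.
    apply: eq_bigr => i _; rewrite !exp_coeffE exprNn /= -signr_odd.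
    by case: (odd i) => /=; rewrite ?expr1 ?expr0; field;
      rewrite pnatr_eq0 -lt0n fact_gt0.
by rewrite /euler_nb; case: xgetP => [? -> //|/(_ E)].
Unshelve. all: by end_near. Qed.

End existence.

(* Main.v *)
Require Import Defs.
From HB Require Import structures.
From mathcomp Require Import all_boot all_order all_algebra.
From mathcomp Require Import ring lra.
From mathcomp Require Import all_classical all_reals all_analysis.
From mathcomp Require Import measurable_realfun.

Set Implicit Arguments.
Unset Strict Implicit.
Unset Printing Implicit Defensive.

Import Order.TTheory GRing.Theory Num.Theory.
Import numFieldNormedType.Exports.

Local Open Scope classical_set_scope.
Local Open Scope ring_scope.

(** Write h = T / 2.  The solution is the Euler perfect spline: the T-periodic
function x with x(t + h) = - x(t) whose n-th derivative is the square wave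
equal to 1 on [0, h] and to -1 on ]h, T].  Its range contains a value c with
|c| = K_n T^n = 1 / L, and also - c by antiperiodicity.  If x(p) = |c| and
x(q) = - |c|, let tau be p on [0, h] and q on ]h, T]; then L x(tau(t)) is the
square wave, that is, the n-th derivative of x.

On [0, h] the spline is a polynomial P_n, where P_0 = 1, P_{k+1}' = P_k and
P_{k+1}(h) = - P_{k+1}(0) ([euler_chain]); on [h, T] it is - P_n(t - h).  The
sign condition makes the two pieces fit together with n - 1 continuous
derivatives ([piecewise_diff_quot], [spline_diff_quot]).

The value c is P_n(T / 4) for even n and P_n(0) for odd n.  For even n, the
chain centred at T / 4 has constants E_k / k! up to scaling, because
cosh(t) (sum_k E_k t^k / k!) = 1 is exactly the sign condition
([euler_chain_of_even_recurrence]).  For odd n, P_k is a difference of two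
translates of a Bernoulli polynomial of degree k + 1
([euler_chain_of_bernoulli]) and P_n(0) follows from the duplication formula
for Bernoulli polynomials ([bernoulli_chain_half]).  The recurrences satisfied
by the numbers B_k and E_k come from their generating functions, by uniqueness
of power series coefficients ([reciprocal_egf_conv]).

That c is nonzero, without which L would not be 1 / |c|, is a Rolle argument:
a zero of P_{2m+2} inside ]0, h[ would, since P_{2m+2} also vanishes at both
ends, produce a zero of P_{2m} inside ]0, h[ ([euler_chain_even_neq0]). *)

(** * Polynomial chains with prescribed boundary values *)

Section appell.
Variable R : realType.
Implicit Types (p : {poly R}) (c : nat -> R) (P C D : nat -> {poly R}).

Lemma deriv_eq0 p : p^`() = 0 -> p = p.[0]%:P.
Proof.
move=> p0; apply/polyP => -[|i]; rewrite coefC /= ?horner_coef0//.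
have /eqP := congr1 (fun q : {poly R} => q`_i) p0.
by rewrite coef_deriv coef0 mulrn_eq0 /= => /eqP.
Qed.

Lemma horner_affine p (a b x : R) :
  (p \Po (a *: 'X + b%:P)).[x] = p.[a * x + b].
Proof. by rewrite horner_comp !hornerE. Qed.

Lemma deriv_affine p (a b : R) :
  (p \Po (a *: 'X + b%:P))^`() = a *: (p^`() \Po (a *: 'X + b%:P)).
Proof.
by rewrite deriv_comp derivD derivC addr0 derivZ derivX alg_polyC mulrC mul_polyC.
Qed.

(** The k-th coefficient in z of (sum_j c_j z^j) exp(x z), as a polynomial in x. *)
Definition appell c k : {poly R} :=
  \sum_(j < k.+1) (c j / (k - j)`!%:R) *: 'X^(k - j).

Lemma deriv_appell c k : (appell c k.+1)^`() = appell c k.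
Proof.
rewrite /appell big_ord_recr /= subnn expr0 derivD derivZ derivC scaler0 addr0.
rewrite linear_sum /=; apply: eq_bigr => j _.
have jk : (j <= k)%N by rewrite -ltnS.
rewrite derivZ subSn// derivXn /= -scalerMnr scalerMnl factS natrM -mulr_natr.
congr (_ *: _); field.
by rewrite addrC natr1 !pnatr_eq0 -lt0n fact_gt0.
Qed.

Lemma horner_appell c k (x : R) :
  (appell c k).[x] = \sum_(j < k.+1) c j * (x ^+ (k - j) / (k - j)`!%:R).
Proof.
rewrite /appell horner_sum; apply: eq_bigr => j _.
by rewrite hornerZ hornerXn mulrAC mulrA.
Qed.

Lemma horner_appell0 c k : (appell c k).[0] = c k.
Proof.
rewrite horner_appell big_ord_recr /= subnn expr0 divr1 mulr1 big1 ?add0r//.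
by move=> j _; rewrite expr0n subn_eq0 leqNgt ltn_ord mul0r mulr0.
Qed.

(** The only solution is C_k(x) = B_k(x) / k!, with B_k the Bernoulli polynomial. *)
Definition bernoulli_chain C : Prop :=
  [/\ C 0%N = 1, forall k, (C k.+1)^`() = C k
    & forall k, (C k.+1).[1] = (C k.+1).[0] + (k == 0%N)%:R].

(** Two chains that agree up to order k differ by a constant at order k + 1; this
constant is the slope of the difference at order k + 2, whose values at 0 and 1
are equal, so it vanishes. *)
Lemma bernoulli_chain_uniq C D k :
  bernoulli_chain C -> bernoulli_chain D -> C k = D k.
Proof.
move=> [C0 dC bC] [D0 dD bD]; elim: k => [|k IH]; first by rewrite C0 D0.
have /deriv_eq0 : (C k.+1 - D k.+1)^`() = 0 by rewrite derivB dC dD IH subrr.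
set u := _.[0] => uE.
have /deriv_eq0 vE : (C k.+2 - D k.+2 - u *: 'X)^`() = 0.
  by rewrite !derivB dC dD uE derivZ derivX alg_polyC subrr.
have := congr1 (fun p => p.[1]) vE; rewrite !hornerE bC bD.
move=> u0; apply/eqP; rewrite -subr_eq0 uE polyC_eq0; apply/eqP.
by move: u0; set x := (C _).[0]; set y := (D _).[0]; lra.
Qed.

(** Differentiation and the telescoping of the jump over the two halves of [0, 1]
show that the right-hand side of the duplication formula
B_k(x) = 2^(k-1) (B_k(x/2) + B_k((x+1)/2)) is again a Bernoulli chain. *)
Lemma bernoulli_chain_duplication C : bernoulli_chain C ->
  bernoulli_chain (fun k => (2 ^+ k / 2) *:
    ((C k \Po (2^-1 *: 'X + 0%:P)) + (C k \Po (2^-1 *: 'X + 2^-1%:P)))).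
Proof.
move=> hC; have [C0 dC bC] := hC; split.
- rewrite C0 -polyC1 !comp_polyC expr0 -polyCD -mul_polyC -polyCM.
  by congr (_%:P); field.
- move=> k; rewrite derivZ derivD !deriv_affine dC -scalerDr scalerA exprS.
  by congr (_ *: _); field.
- move=> k; rewrite !(hornerZ, hornerD) !horner_affine.
  rewrite ?(mulr1, mulr0, addr0, add0r) (_ : 2^-1 + 2^-1 = 1 :> R); last by field.
  rewrite bC; case: k => [|k] /=; last by rewrite !addr0 addrC.
  by rewrite expr1; field.
Qed.

(** The duplication formula at 0, solved for the value at 1/2. *)
Lemma bernoulli_chain_half C k : bernoulli_chain C ->
  (C k).[2^-1] = (2 / 2 ^+ k - 1) * (C k).[0].
Proof.
move=> hC.
have := bernoulli_chain_uniq k hC (bernoulli_chain_duplication hC).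
move=> /(congr1 (fun p => p.[0])).
rewrite !(hornerZ, hornerD) !horner_affine mulr0 !add0r.
have : (2 ^+ k : R) != 0 by rewrite expf_neq0.
move: (2 ^+ k) (C k).[0] (C k).[2^-1] => z x y z0 xE.
by rewrite mulrBl mul1r {1}xE; field.
Qed.

(** The hypothesis says (sum_j c_j z^j) (exp z - 1) / z = 1, and the jump between
0 and 1 of the associated chain is the coefficient of this product. *)
Lemma appell_bernoulli_chain c : c 0%N = 1 ->
  (forall k, \sum_(j < k.+1) c j / (k - j).+1`!%:R = (k == 0%N)%:R) ->
  bernoulli_chain (appell c).
Proof.
move=> c0 c1; split.
- by rewrite /appell big_ord_recl big_ord0 addr0 c0 fact0 divr1 expr0 scale1r.
- exact: deriv_appell.
- move=> k; rewrite horner_appell0 horner_appell big_ord_recr /= subnn addrC.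
  rewrite expr0 divr1 mulr1 -c1; congr (_ + _); apply: eq_bigr => j _.
  by rewrite expr1n mul1r subSn// -ltnS.
Qed.

End appell.

Section euler_chain.
Variables (R : realType) (h : R).
Implicit Types (P Q : nat -> {poly R}).

(** The only solution is P_k(x) = h^k E_k(x / h) / k!, with E_k the Euler
polynomial, when h is nonzero. *)
Definition euler_chain P : Prop :=
  [/\ P 0%N = 1, forall k, (P k.+1)^`() = P k
    & forall k, (P k.+1).[h] = - (P k.+1).[0]].

Lemma euler_chain_uniq P Q k : euler_chain P -> euler_chain Q -> P k = Q k.
Proof.
move=> [P0 dP bP] [Q0 dQ bQ]; elim: k => [|k IH]; first by rewrite P0 Q0.
have /deriv_eq0 : (P k.+1 - Q k.+1)^`() = 0 by rewrite derivB dP dQ IH subrr.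
set u := _.[0] => uE.
have := congr1 (fun p => p.[h]) uE; rewrite !hornerE bP bQ.
rewrite -[u]/((P k.+1 - Q k.+1).[0]) !hornerE => u0.
apply/eqP; rewrite -subr_eq0 uE polyC_eq0 /u !hornerE; apply/eqP.
by move: u0; set x := (P _).[0]; set y := (Q _).[0]; lra.
Qed.

(** The chain reflected about h / 2, with alternating signs, is again an Euler
chain, so it is the chain itself. *)
Lemma euler_chain_sym P k : euler_chain P ->
  (P k).[h] = (- 1) ^+ k * (P k).[0].
Proof.
move=> hP; have [P0 dP bP] := hP.
pose Q i : {poly R} := (- 1) ^+ i *: (P i \Po ((- 1) *: 'X + h%:P)).
suff /(euler_chain_uniq k hP) {1}-> : euler_chain Q.
  by rewrite /Q !hornerZ !horner_affine mulN1r addNr.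
split.
- by rewrite /Q P0 scale1r -polyC1 comp_polyC.
- by move=> i; rewrite /Q derivZ deriv_affine dP scalerA exprSr -mulrA mulrNN !mulr1.
- move=> i; rewrite /Q !hornerZ !horner_affine mulr0 add0r mulN1r addNr.
  by rewrite bP mulrN opprK.
Qed.

Lemma poly_rolle (p : {poly R}) (a b : R) : a < b -> p.[a] = p.[b] ->
  exists2 c, a < c < b & p^`().[c] = 0.
Proof.
move=> ab pab.
have [|| c] := @Rolle R (horner p) a b ab _ _ pab.
- by move=> x _; exact: derivable_horner.
- by apply: continuous_subspaceT; exact: continuous_horner.
rewrite in_itv /= => cab dc; exists c => //.
by rewrite -(@derive_val _ _ _ _ _ _ _ dc) (@derive_val _ _ _ _ _ _ _ (is_derive_poly p c)).
Qed.

(** By symmetry and the sign condition P_{2m+2} vanishes at 0 and h.  A further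
zero in between would give two zeros of P_{2m+1}, hence a zero of P_{2m}. *)
Lemma euler_chain_even_neq0 P m : euler_chain P ->
  forall t, 0 < t < h -> (P m.*2).[t] != 0.
Proof.
move=> hP; have [P0 dP bP] := hP.
elim: m => [|m IH] t /andP[t0 th]; first by rewrite P0 hornerE oner_eq0.
rewrite doubleS; apply/eqP => Pt.
have P20 : (P m.*2.+2).[0] = 0.
  have := euler_chain_sym m.*2.+2 hP.
  rewrite bP -signr_odd /= negbK odd_double mul1r.
  by set x := _.[0]; lra.
have P2h : (P m.*2.+2).[h] = 0 by rewrite bP P20 oppr0.
have [c /andP[c0 ct]] := @poly_rolle (P m.*2.+2) _ _ t0 (etrans P20 (esym Pt)).
have [d /andP[td dh]] := @poly_rolle (P m.*2.+2) _ _ th (etrans Pt (esym P2h)).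
rewrite dP => Pd Pc.
have cd : c < d by apply: lt_trans td.
have [e /andP[ce ed]] := poly_rolle cd (etrans Pc (esym Pd)).
rewrite dP => /eqP; apply/negP/IH.
by rewrite (lt_trans c0)// (lt_trans ed).
Qed.

(** Vanishing at 0 means vanishing at h as well, hence a zero of P_{2m} in
between. *)
Lemma euler_chain_odd_neq0 P m : 0 < h -> euler_chain P -> (P m.*2.+1).[0] != 0.
Proof.
move=> h_gt0 hP; have [P0 dP bP] := hP; apply/eqP => Pm0.
have Pmh : (P m.*2.+1).[h] = 0 by rewrite bP Pm0 oppr0.
have [c c0h] := poly_rolle h_gt0 (etrans Pm0 (esym Pmh)).
by rewrite dP => /eqP; apply/negP/(euler_chain_even_neq0 _ hP).
Qed.

End euler_chain.

Section chains.
Variables (R : realType) (T : R).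
Hypothesis T_gt0 : 0 < T.
Implicit Types (c : nat -> R).

Let T_neq0 : T != 0. Proof. exact: lt0r_neq0. Qed.

(** The half-period square wave has two opposite jumps, so its primitives are
differences of two half-period translates of Bernoulli functions. *)
Lemma euler_chain_of_bernoulli C : bernoulli_chain C ->
  euler_chain (T / 2) (fun k => (2 * T ^+ k) *:
    ((C k.+1 \Po (T^-1 *: 'X + 2^-1%:P)) - (C k.+1 \Po (T^-1 *: 'X + 0%:P)))).
Proof.
move=> [C0 dC bC]; split.
- have : (C 1%N - 'X)^`() = 0 by rewrite derivB dC C0 derivX subrr.
  move=> /deriv_eq0 /eqP; rewrite subr_eq => /eqP ->.
  rewrite expr0 mulr1 -polyC1 !comp_polyD !comp_polyX !comp_polyC.
  transitivity (2 *: (2^-1)%:P : {poly R}); first by congr (_ *: _); ring.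
  by rewrite -mul_polyC -polyCM divff.
- move=> k; rewrite derivZ derivB !deriv_affine dC -scalerBr scalerA exprS.
  by congr (_ *: _); field.
- move=> k; rewrite !hornerZ !hornerD !hornerN !horner_affine.
  rewrite mulr0 !add0r (_ : T^-1 * (T / 2) = 2^-1); last by field.
  rewrite (_ : 2^-1 + 2^-1 = 1 :> R); last by field.
  by rewrite addr0 bC addr0 -mulrN opprB.
Qed.

(** The hypothesis says (sum_j c_j z^j) cosh z = 1; it is the sign condition on
[-1, 1] for the chain with constants c_j at the midpoint 0, which is then
transported affinely to [0, T / 2]. *)
Lemma euler_chain_of_even_recurrence c :
  (forall k, \sum_(j < k.+1) c j * ((~~ odd (k - j))%:R / (k - j)`!%:R)
     = (k == 0%N)%:R) ->
  euler_chain (T / 2) (fun k => (T / 4) ^+ k *: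
    (appell c k \Po ((T / 4)^-1 *: 'X + (- 1)%:P))).
Proof.
move=> c1; split.
- have := c1 0%N; rewrite big_ord_recl big_ord0 addr0 subnn fact0 divr1 mulr1 => c0.
  rewrite /appell big_ord_recl big_ord0 addr0 c0 fact0 divr1 expr0 !scale1r.
  by rewrite -polyC1 comp_polyC.
- move=> k; rewrite derivZ deriv_affine deriv_appell scalerA exprSr.
  by congr (_ *: _); field.
- move=> k; rewrite !hornerZ !horner_affine mulr0 add0r -mulrN; congr (_ * _).
  rewrite (_ : _ - 1 = 1); last by field.
  apply/eqP; rewrite -addr_eq0 !horner_appell -big_split /=; apply/eqP.
  transitivity (\sum_(j < k.+2)
      2 * (c j * ((~~ odd (k.+1 - j))%:R / (k.+1 - j)`!%:R))); last first.
    by rewrite -mulr_sumr c1 mulr0.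
  apply: eq_bigr => j _; rewrite expr1n -signr_odd.
  by case: (odd _) => /=; ring.
Qed.

End chains.

(** * Recurrences from exponential generating functions *)

Section power_series.
Variable R : realType.
Implicit Types (a b c : nat -> R) (g : R -> R) (t : R).

Lemma pseriesS c t N :
  pseries c t N.+1 = c 0%N + t * pseries (fun k => c k.+1) t N.
Proof.
rewrite /pseries /series /= big_nat_recl// expr0 mulr1 mulr_sumr.
by congr (_ + _); apply: eq_bigr => i _; rewrite exprS mulrCA.
Qed.

Lemma geometric_sum_le2 (q : R) N : 0 <= q <= 2^-1 -> \sum_(i < N) q ^+ i <= 2.
Proof.
move=> /andP[q0 q2]; elim: N => [|N IH]; first by rewrite big_ord0.
rewrite big_ord_recl expr0.
under eq_bigr do rewrite exprS.
rewrite -mulr_sumr.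
have : q * (\sum_(i < N) q ^+ i) <= 2^-1 * 2.
  by apply: ler_pM => //; apply: sumr_ge0 => i _; rewrite exprn_ge0.
by lra.
Qed.

(** Convergence at some r > 0 bounds c_k r^k by M, so the series without its
constant term is at most 2 M t / r in absolute value for 0 < t <= r / 2; a small
enough t makes it at most half of |c_0|, and the limit cannot be 0 unless
c_0 = 0. *)
Lemma pseries_coef0_eq0 c :
  (\forall t \near 0^', pseries c t @ \oo --> (0 : R)) -> c 0%N = 0.
Proof.
move=> hc.
have [e /= e0 he] := hc.
pose r := e / 2.
have r0 : 0 < r by rewrite divr_gt0.
have hr : pseries c r @ \oo --> (0 : R).
  apply: he; rewrite /= ?sub0r ?normrN ?gtr0_norm ?gt_eqF// /r.
  by lra.
have /cvg_series_bounded : cvgn (pseries c r) by apply/cvg_ex; exists 0.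
move=> /pinfty_ex_gt0[M M0 hM].
have cM k : `|c k| * r ^+ k <= M.
  by have := hM k I; rewrite /= normrM normrX (gtr0_norm r0).
apply/eqP; rewrite -normr_eq0 -[_ == _]negbK; apply/negP => c0.
have {}c0 : 0 < `|c 0%N| by rewrite lt_neqAle eq_sym c0 /=.
(* r / 2 keeps the geometric ratio t / r below 1/2; the other bound makes
   2 M t / r at most |c_0| / 2. *)
pose t := Num.min (r / 2) (`|c 0%N| * r / (4 * M)).
have t0 : 0 < t by rewrite lt_min !divr_gt0 ?mulr_gt0.
have tr : t / r <= 2^-1.
  by rewrite ler_pdivrMr// mulrC /t ge_min lexx.
have tM : t * (2 * M / r) <= `|c 0%N| / 2.
  rewrite -ler_pdivlMr ?divr_gt0 ?mulr_gt0//.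
  have -> : `|c 0%N| / 2 / (2 * M / r) = `|c 0%N| * r / (4 * M).
    by field; rewrite !gt_eqF.
  by rewrite /t ge_min lexx orbT.
have tail N : `|pseries (fun k => c k.+1) t N| <= 2 * M / r.
  rewrite /pseries /series /= big_mkord (le_trans (ler_norm_sum _ _ _))//.
  have tr0 : 0 <= t / r <= 2^-1 by rewrite tr divr_ge0// ltW.
  have := geometric_sum_le2 N tr0.
  rewrite -(ler_pM2l (divr_gt0 M0 r0)) mulr_sumr [leRHS]mulrAC [M * 2]mulrC.
  apply: le_trans; apply: ler_sum => i _.
  rewrite normrM normrX (gtr0_norm t0) expr_div_n.
  have -> : M / r * (t ^+ i / r ^+ i) = M / r ^+ i.+1 * t ^+ i.
    by rewrite exprS; field; rewrite expf_neq0 gt_eqF.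
  by rewrite ler_wpM2r ?exprn_ge0 ?(ltW t0)// ler_pdivlMr ?exprn_gt0.
have : pseries c t @ \oo --> (0 : R).
  apply: he; last by rewrite gt_eqF.
  rewrite /= sub0r normrN gtr0_norm//.
  have : t <= r / 2 by rewrite /t ge_min lexx.
  by rewrite /r; lra.
move=> /cvgrPdist_lt /(_ _ (divr_gt0 c0 (ltr0n R 2)))[N _ /(_ N.+1 (leqnSn N))].
rewrite sub0r normrN pseriesS => tN.
have : `|t * pseries (fun k => c k.+1) t N| <= `|c 0%N| / 2.
  by rewrite normrM gtr0_norm// (le_trans _ tM)// ler_pM2l.
have := ler_normB (c 0%N + t * pseries (fun k => c k.+1) t N)
  (t * pseries (fun k => c k.+1) t N).
by rewrite addrK; lra.
Qed.

(** Once c_0 = 0, dividing by t <> 0 removes it and shifts the coefficients. *)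
Lemma pseries_eq0 c :
  (\forall t \near 0^', pseries c t @ \oo --> (0 : R)) -> forall k, c k = 0.
Proof.
move=> hc k; elim: k c hc => [|k IH] c hc; first exact: pseries_coef0_eq0.
apply: (IH (fun k => c k.+1)).
have c0 := pseries_coef0_eq0 hc.
near=> t.
have t0 : t != 0 by near: t; exact: nbhs_dnbhs_neq.
have ct : pseries c t @ \oo --> (0 : R) by near: t.
rewrite (_ : pseries _ t = fun N => t^-1 * pseries c t N.+1).
  rewrite -[X in _ --> X](mulr0 t^-1); apply: cvgMr.
  by rewrite (cvg_shiftS (pseries c t)).
by apply/funext => N; rewrite pseriesS c0 add0r mulKf.
Unshelve. all: by end_near. Qed.

Lemma pseries_inj a b g :
  (\forall t \near 0^', pseries a t @ \oo --> g t) ->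
  (\forall t \near 0^', pseries b t @ \oo --> g t) -> a = b.
Proof.
move=> ha hb; apply/funext => k; apply/eqP; rewrite -subr_eq0; apply/eqP.
apply: (@pseries_eq0 (fun k => a k - b k)).
near=> t.
rewrite (_ : pseries _ t = pseries a t - pseries b t).
  by rewrite -(subrr (g t)); apply: cvgB; near: t.
apply/funext => N; rewrite /pseries /series /= !fctE -sumrB.
by apply: eq_bigr => i _; rewrite mulrBl.
Unshelve. all: by end_near. Qed.

Lemma size_rcp_seq a n : size (rcp_seq a n) = n.
Proof. by elim: n => //= n IH; rewrite size_rcons IH. Qed.

Lemma nth_rcp_seq a n j : (j < n)%N -> (rcp_seq a n)`_j = (rcp_seq a j.+1)`_j.
Proof.
elim: n => // n IH; rewrite ltnS leq_eqVlt => /orP[/eqP -> //|jn] /=.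
by rewrite nth_rcons size_rcp_seq jn IH.
Qed.

Lemma rcp_seq_conv a k : a 0%N = 1 ->
  \sum_(j < k.+1) (rcp_seq a j.+1)`_j * a (k - j)%N = (k == 0%N)%:R.
Proof.
move=> a0; rewrite big_ord_recr /= subnn a0 mulr1.
rewrite nth_rcons size_rcp_seq ltnn eqxx addrC -addrA -[RHS]addr0; congr (_ + _).
rewrite addrC; apply/eqP; rewrite subr_eq0; apply/eqP.
by apply: eq_bigr => j _; rewrite [in RHS]nth_rcp_seq.
Qed.

(** The recursively computed reciprocal series [rcp_seq a] also converges to 1 / h,
so by uniqueness its coefficients are the c_j / j!, and they satisfy the Cauchy
product relation by construction. *)
Lemma reciprocal_egf_conv c a (h : R -> R) : a 0%N = 1 ->
  (forall N, \sum_(i < N) `|a i.+1| <= 1) ->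
  (\forall t \near 0^', h t != 0 /\ pseries a t @ \oo --> h t) ->
  is_egf c (fun t => (h t)^-1) ->
  forall k, \sum_(j < k.+1) (c j / j`!%:R) * a (k - j)%N = (k == 0%N)%:R.
Proof.
move=> a0 a1 ah hc k; rewrite -(rcp_seq_conv k a0).
have rc : \forall t \near 0^',
    pseries (fun k => (rcp_seq a k.+1)`_k) t @ \oo --> (h t)^-1.
  near=> t.
  have [ht aht] : h t != 0 /\ pseries a t @ \oo --> h t by near: t.
  apply: reciprocal_pseries => //.
  near: t; apply: nbhs_dnbhs; apply/nbhs_normP; exists 2^-1 => //=.
  by move=> t; rewrite /= sub0r normrN => /ltW.
have cE j := congr1 (fun u : nat -> R => u j) (pseries_inj hc rc).
by apply: eq_bigr => j _; rewrite -cE.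
Unshelve. all: by end_near. Qed.

Lemma bernoulli_recurrence k :
  \sum_(j < k.+1) (bernoulli_nb R j / j`!%:R) / (k - j).+1`!%:R
    = (k == 0%N)%:R.
Proof.
refine (@reciprocal_egf_conv (bernoulli_nb R) (fun i => i.+1`!%:R^-1)
  (fun t => (expR t - 1) / t) _ _ _ _ k).
- by rewrite invr1.
- move=> N; apply: le_trans (inv_fact_sum1 R N); apply: ler_sum => i _.
  by rewrite ger0_norm ?invr_ge0.
- near=> t; have t0 : t != 0 by near: t; exact: nbhs_dnbhs_neq.
  split.
    by rewrite mulf_neq0 ?invr_eq0// subr_eq0 -expR0 (inj_eq (@expR_inj R)).
  have -> : pseries (fun i => i.+1`!%:R^-1) t
      = fun N => t^-1 * (series (exp_coeff t) N.+1 - 1).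
    apply/funext => N; have := pseriesS (fun i => i`!%:R^-1) t N.
    rewrite invr1 => e; apply: (mulfI t0); rewrite mulVKf//.
    apply/eqP; rewrite eq_sym subr_eq addrC; apply/eqP; rewrite -e.
    by rewrite /pseries /series /=; apply: eq_bigr => i _; rewrite exp_coeffE.
  rewrite mulrC; apply: cvgMr; apply: cvgB; last exact: cvg_cst.
  by rewrite (cvg_shiftS (series (exp_coeff t))); exact: is_cvg_series_exp_coeff.
- have := @bernoulli_numbersP R; rewrite /bernoulli_numbers.
  by congr (is_egf _ _); apply/funext => t; rewrite invf_div.
Unshelve. all: by end_near. Qed.

Lemma euler_recurrence k :
  \sum_(j < k.+1) (euler_nb R j / j`!%:R) *
      ((~~ odd (k - j))%:R / (k - j)`!%:R) = (k == 0%N)%:R.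
Proof.
refine (@reciprocal_egf_conv (euler_nb R)
  (fun i => (~~ odd i)%:R / i`!%:R) (@cosh R) _ _ _ _ k).
- by rewrite fact0 divr1.
- case=> [|N]; first by rewrite big_ord0.
  rewrite big_ord_recl /= mul0r normr0 add0r.
  apply: le_trans (inv_fact_sum1 R N); apply: ler_sum => i _.
  rewrite ger0_norm ?divr_ge0// ler_piMl// ?invr_ge0//.
  by case: (~~ _).
- near=> t; split.
    by rewrite mulf_neq0 ?invr_eq0// gt_eqF// addr_gt0// expR_gt0.
  have -> : pseries (fun i => (~~ odd i)%:R / i`!%:R) t
      = fun N => (series (exp_coeff t) N + series (exp_coeff (- t)) N) / 2.
    apply/funext => N; rewrite /pseries /series /= -big_split /= mulr_suml.
    apply: eq_bigr => i _; rewrite !exp_coeffE exprNn /= -signr_odd.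
    by case: (odd i) => /=; field; rewrite pnatr_eq0 -lt0n fact_gt0.
  by apply: cvgMl; apply: cvgD; exact: is_cvg_series_exp_coeff.
- exact: euler_numbersP.
Unshelve. all: by end_near. Qed.

End power_series.

(** * Derivatives and absolute continuity of piecewise polynomials *)

Section one_sided_derivative.
Variables (R : realType) (a b : R).
Hypothesis ab : a < b.
Implicit Types (f g : R -> R) (t l : R).

Lemma within_itv_dnbhs_proper t : a <= t <= b ->
  ProperFilter (within `[a, b]%classic t^').
Proof.
move=> /andP[at_ tb]; apply: Build_ProperFilter_ex => A [e /= e0 he].
have [tltb|] := ltP t b.
  exists (Num.min b (t + e / 2)); apply: he => /=.
  - by rewrite ltr_distlC; case: (leP b) => ?; apply/andP; split; lra.
  - by rewrite eq_sym lt_eqF// lt_min tltb; lra.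
  - by rewrite in_itv /= ge_min lexx le_min (ltW ab) /=; lra.
move=> bt; exists (Num.max a (t - e / 2)); apply: he => /=.
- by rewrite ltr_distlC; case: (leP a) => ?; apply/andP; split; lra.
- by rewrite lt_eqF// gt_max (lt_le_trans ab bt) /=; lra.
- by rewrite in_itv /= le_max lexx ge_max (ltW ab) /=; lra.
Qed.

Lemma diff_quot_on_cvg_eq f g t l : a <= t <= b ->
  (forall s, a <= s <= b -> f s = g s) ->
  diff_quot_on a b g t --> l -> diff_quot_on a b f t --> l.
Proof.
move=> tab fg; apply: cvg_trans; apply: near_eq_cvg.
rewrite near_withinE; near=> s => /=; rewrite in_itv /= => sab.
by rewrite !fg.
Unshelve. all: by end_near. Qed.

Lemma derivable_onP f t l : a <= t <= b ->
  diff_quot_on a b f t --> l -> derivable_on a b f t /\ deriv_on a b f t = l.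
Proof.
move=> tab fl; have FF := within_itv_dnbhs_proper tab.
by split; [apply/cvg_ex; exists l|exact: cvg_lim].
Qed.

Lemma lipschitz_abs_continuous f (k : R) :
  (forall u v, a <= u -> u <= v -> v <= b -> `|f v - f u| <= k * (v - u)) ->
  abs_continuous_on a b f.
Proof.
move=> fk e e0; have k1 : 0 < `|k| + 1 by rewrite ltr_wpDl.
exists (e / (`|k| + 1)); first by rewrite divr_gt0.
move=> m u v uv _; rewrite ltr_pdivlMr// => sum_lt.
apply: le_lt_trans sum_lt; rewrite mulr_suml; apply: ler_sum => i _.
have [au [uv' vb]] := uv i.
rewrite (le_trans (fk _ _ au uv' vb))// mulrC ler_wpM2l ?subr_ge0//.
by rewrite (le_trans (ler_norm k))// lerDl.
Qed.

End one_sided_derivative.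

Section piecewise.
Variables (R : realType) (h : R).
Implicit Types (p q : {poly R}) (a b t : R).

Definition piecewise p q t : R := if t <= h then p.[t] else q.[t].

(** The difference quotient is itself a polynomial in s, by the factor theorem. *)
Lemma horner_diff_quot p t :
  (p.[s] - p.[t]) / (s - t) @[s --> t^'] --> p^`().[t].
Proof.
have /factor_theorem[q pE] : root (p - p.[t]%:P) t.
  by rewrite rootE !hornerE subrr.
have -> : p^`().[t] = q.[t].
  have := congr1 (fun r => r^`().[t]) pE.
  by rewrite derivB derivC subr0 derivM derivXsubC !hornerE subrr mulr0 add0r.
have : q.[s] @[s --> t^'] --> q.[t].
  by apply: cvg_within_filter; exact: continuous_horner.
apply: cvg_trans; apply: near_eq_cvg; near=> s.
have st : s - t != 0 by rewrite subr_eq0; near: s; exact: nbhs_dnbhs_neq.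
have := congr1 (fun r => r.[s]) pE; rewrite !hornerE => ->.
by rewrite mulfK.
Unshelve. all: by end_near. Qed.

(** At the knot both pieces have the same value and the same slope, and every
difference quotient of the glued function is a quotient of one of them. *)
Lemma piecewise_diff_quot a b p q t :
  p.[h] = q.[h] -> (t = h -> p^`().[h] = q^`().[h]) ->
  diff_quot_on a b (piecewise p q) t --> piecewise p^`() q^`() t.
Proof.
move=> pqh dpqh; suff : (piecewise p q s - piecewise p q t) / (s - t) @[s --> t^']
    --> piecewise p^`() q^`() t.
  by apply: cvg_trans; apply: cvg_app; exact: cvg_within.
have [th|th|th] := ltgtP t h.
- have -> : piecewise p^`() q^`() t = p^`().[t] by rewrite /piecewise ltW.
  apply: cvg_trans (@horner_diff_quot p t); apply: near_eq_cvg.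
  near=> s; rewrite /piecewise (ltW th) ifT//; apply/ltW.
  by near: s; apply: nbhs_dnbhs; exact: lt_nbhsl.
- have -> : piecewise p^`() q^`() t = q^`().[t] by rewrite /piecewise leNgt th.
  apply: cvg_trans (@horner_diff_quot q t); apply: near_eq_cvg.
  near=> s; rewrite /piecewise [t <= h]leNgt th /= ifF//; apply/negbTE.
  by rewrite -ltNge; near: s; apply: nbhs_dnbhs; exact: lt_nbhsr.
- have {}dpqh := dpqh th; subst t.
  have -> : piecewise p^`() q^`() h = p^`().[h] by rewrite /piecewise lexx.
  move=> U /= Up.
  have := @horner_diff_quot p h _ Up.
  rewrite dpqh in Up; have := @horner_diff_quot q h _ Up.
  rewrite !near_simpl => qU pU.
  near=> s; rewrite /= {2}/piecewise lexx /piecewise; case: ifP => _.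
    by near: s; exact: pU.
  by rewrite pqh; near: s; exact: qU.
Unshelve. all: by end_near. Qed.

Lemma poly_lipschitz p (m : R) : exists k, forall u v,
  `|u| <= m -> `|v| <= m -> `|p.[v] - p.[u]| <= k * `|v - u|.
Proof.
elim/poly_ind: p => [|p c [k IH]].
  by exists 0 => u v _ _; rewrite !horner0 subrr normr0 mul0r.
have [B hB] := poly_disk_bound p m.
exists (k * m + B) => u v um vm; rewrite !hornerE.
have -> : p.[v] * v + c - (p.[u] * u + c)
    = (p.[v] - p.[u]) * v + p.[u] * (v - u) by ring.
rewrite (le_trans (ler_normD _ _))// [leRHS]mulrDl !normrM lerD//; last first.
  by rewrite ler_wpM2r// hB.
by rewrite mulrAC ler_pM// IH.
Qed.

(** An increment across the knot splits into one increment of each piece. *)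
Lemma piecewise_lipschitz a b p q : p.[h] = q.[h] ->
  exists k, forall u v, a <= u -> u <= v -> v <= b ->
    `|piecewise p q v - piecewise p q u| <= k * (v - u).
Proof.
move=> pqh; pose m := `|a| + `|b| + `|h|.
have [k kP] := poly_lipschitz p m; have [l lP] := poly_lipschitz q m.
have im x : a <= x -> x <= b -> `|x| <= m.
  move=> ax xb; rewrite ler_norml /m.
  have := ler_norm b; have := ler_norm (- a); rewrite normrN.
  have := normr_ge0 a; have := normr_ge0 b; have := normr_ge0 h; lra.
have hm : `|h| <= m by rewrite lerDr addr_ge0.
exists (`|k| + `|l|) => u v au uv vb.
have {}kP x y : `|x| <= m -> `|y| <= m -> x <= y ->
    `|p.[y] - p.[x]| <= (`|k| + `|l|) * (y - x).
  move=> xm ym xy; rewrite (le_trans (kP x y xm ym))//.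
  rewrite ger0_norm ?subr_ge0// ler_wpM2r ?subr_ge0//.
  by rewrite (le_trans (ler_norm k))// lerDl.
have {}lP x y : `|x| <= m -> `|y| <= m -> x <= y ->
    `|q.[y] - q.[x]| <= (`|k| + `|l|) * (y - x).
  move=> xm ym xy; rewrite (le_trans (lP x y xm ym))//.
  rewrite ger0_norm ?subr_ge0// ler_wpM2r ?subr_ge0//.
  by rewrite (le_trans (ler_norm l))// lerDr.
have um : `|u| <= m by apply: im => //; apply: le_trans vb.
have vm : `|v| <= m by apply: im => //; apply: le_trans uv.
rewrite /piecewise; case: (leP v h) => vh; case: (leP u h) => uh.
- exact: kP.
- by have := lt_le_trans uh uv; rewrite ltNge vh.
- have -> : q.[v] - p.[u] = (q.[v] - q.[h]) + (p.[h] - p.[u]).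
    by rewrite pqh; ring.
  have -> : v - u = (v - h) + (h - u) by ring.
  rewrite (le_trans (ler_normD _ _))// mulrDr lerD//.
    by apply: lP => //; exact: ltW.
  exact: kP.
- exact: lP.
Qed.

End piecewise.

(** * The Euler spline and the boundary value problem *)

Section spline.
Variables (R : realType) (T : R) (P : nat -> {poly R}).
Hypotheses (T_gt0 : 0 < T) (chainP : euler_chain (T / 2) P).
Implicit Types (t s : R) (n k : nat).

Let h := T / 2.

Definition antiperiodic_shift (p : {poly R}) : {poly R} :=
  - (p \Po (1 *: 'X + (- h)%:P)).

Lemma horner_antiperiodic_shift p t :
  (antiperiodic_shift p).[t] = - p.[t - h].
Proof. by rewrite hornerN horner_affine mul1r. Qed.

Lemma deriv_antiperiodic_shift p :
  (antiperiodic_shift p)^`() = antiperiodic_shift p^`().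
Proof. by rewrite derivN deriv_affine scale1r. Qed.

Definition spline k : R -> R :=
  piecewise h (P k) (antiperiodic_shift (P k)).

Lemma spline_glue k : (P k.+1).[h] = (antiperiodic_shift (P k.+1)).[h].
Proof. by have [_ _ ->] := chainP; rewrite horner_antiperiodic_shift subrr. Qed.

(** The only place where differentiation fails is the jump of the square wave
[spline 0] at the knot. *)
Lemma spline_diff_quot k t : (0 < k)%N || (t != h) ->
  diff_quot_on 0 T (spline k.+1) t --> spline k t.
Proof.
move=> kt; have [_ dP _] := chainP; rewrite /spline -(dP k).
rewrite -deriv_antiperiodic_shift.
apply: piecewise_diff_quot; first exact: spline_glue.
move=> th; move: kt; rewrite th eqxx orbF; case: k => // k _.
by rewrite deriv_antiperiodic_shift dP spline_glue.
Qed.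

Lemma derivn_on_spline n k t : (k < n)%N -> 0 <= t <= T ->
  derivn_on 0 T k (spline n) t = spline (n - k) t.
Proof.
elim: k t => [|k IH] t kn t0T; first by rewrite subn0.
rewrite /derivn_on iterS -/(derivn_on 0 T k (spline n)).
apply: (proj2 (derivable_onP T_gt0 t0T _)).
apply: (diff_quot_on_cvg_eq t0T (g := spline (n - k))).
  by move=> s; apply: IH; apply: ltnW.
rewrite -(subnSK (ltnW kn)).
by apply: spline_diff_quot; rewrite subn_gt0 kn.
Qed.

Lemma derivn_on_spline_cvg n k t : (k < n)%N -> 0 <= t <= T ->
  (k.+1 < n)%N || (t != h) ->
  diff_quot_on 0 T (derivn_on 0 T k (spline n)) t --> spline (n - k.+1) t.
Proof.
move=> kn t0T kt; apply: (diff_quot_on_cvg_eq t0T (g := spline (n - k))).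
  by move=> s; apply: derivn_on_spline.
by rewrite -(subnSK kn); apply: spline_diff_quot; rewrite subn_gt0.
Qed.

Lemma AC_on_spline n : AC_on 0 T n (spline n.+1).
Proof.
split=> [k t kn t0T|k kn].
  apply: (proj1 (derivable_onP T_gt0 t0T (derivn_on_spline_cvg _ t0T _))).
  - exact: leqW.
  - by rewrite ltnS kn.
have [m mP] := piecewise_lipschitz 0 T (spline_glue (n - k)).
apply: (@lipschitz_abs_continuous _ _ _ _ m) => u v u0 uv vT.
rewrite !derivn_on_spline ?ltnS// ?u0 ?(le_trans u0)// ?vT ?(le_trans uv)//.
by rewrite subSn//; exact: mP.
Qed.

Lemma spline_periodic k : spline k.+1 0 = spline k.+1 T.
Proof.
have [_ _ bP] := chainP.
have h_lt : h < T by move: T_gt0; rewrite /h; lra.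
have h_ge0 : 0 <= h by move: T_gt0; rewrite /h; lra.
rewrite /spline /piecewise h_ge0 leNgt h_lt /=.
rewrite horner_antiperiodic_shift (_ : T - h = h); last by rewrite /h; lra.
by rewrite bP opprK.
Qed.

Lemma spline_half_shift k s : 0 <= s <= h ->
  spline k.+1 (s + h) = - spline k.+1 s.
Proof.
have [_ _ bP] := chainP.
move=> /andP[s0 sh]; rewrite /spline /piecewise sh.
(* For s = 0 the shifted point is the knot itself, which belongs to the left
   piece, so the sign condition at h is needed. *)
have [->|sN0] := eqVneq s 0; first by rewrite add0r lexx bP.
rewrite ifF; last by apply/negbTE; rewrite -ltNge ltrDr lt_neqAle eq_sym sN0.
by rewrite horner_antiperiodic_shift addrK.
Qed.

Lemma spline0E t : spline 0 t = if t <= h then 1 else - 1.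
Proof.
have [P0 _ _] := chainP.
by rewrite /spline /piecewise horner_antiperiodic_shift P0 !hornerE.
Qed.

(** The deviation tau only needs the two points where the spline takes the values
c and - c, with c = |P_{n+1}(s)|; they are s and its half-period shift, in an
order given by the sign of P_{n+1}(s). *)
Lemma spline_solution n s : 0 <= s <= h -> (P n.+1).[s] != 0 ->
  exists tau : R -> R,
    [/\ (forall t, 0 <= t <= T -> 0 <= tau t <= T),
        measurable_fun `[0, T]%classic tau &
        exists x : R -> R,
          [/\ AC_on 0 T n x,
              {ae @lebesgue_measure R, forall t, 0 <= t <= T ->
                 derivable_on 0 T (derivn_on 0 T n x) t /\
                 derivn_on 0 T n.+1 x t = `|(P n.+1).[s]|^-1 * x (tau t)},
              (forall i, (i < n.+1)%N ->
                 derivn_on 0 T i x 0 = derivn_on 0 T i x T) &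
              exists s t, [/\ 0 <= s <= T, 0 <= t <= T & x s <> x t]]].
Proof.
move=> s0h Ps0; have /andP[s0 sh] := s0h.
have hT : h + h = T by rewrite /h; lra.
have sE : spline n.+1 s = (P n.+1).[s] by rewrite /spline /piecewise sh.
have := spline_half_shift n s0h; rewrite sE => shE.
have [p [q [p0T q0T xp xq]]] : exists p q, [/\ 0 <= p <= T, 0 <= q <= T,
    spline n.+1 p = `|(P n.+1).[s]| & spline n.+1 q = - `|(P n.+1).[s]|].
  case: (leP 0 (P n.+1).[s]) => Ps.
    exists s, (s + h); rewrite sE shE ger0_norm//.
    by split => //; apply/andP; split; lra.
  exists (s + h), s; rewrite sE shE ltr0_norm// opprK.
  by split => //; apply/andP; split; lra.
have N0 : 0 < `|(P n.+1).[s]| by rewrite normr_gt0.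
exists (fun t => if t <= h then p else q); split.
- by move=> t _; case: ifP.
- apply: measurable_funTS; apply: measurable_fun_ifT => //.
  by apply: measurable_fun_ler.
exists (spline n.+1); split.
- exact: AC_on_spline.
(* The equation holds off the knot, where the square wave jumps. *)
- exists [set h]; split; [exact: measurable_set1|exact: lebesgue_measure_set1|].
  move=> t /= Ht; apply: contrapT => /eqP th; apply: Ht => t0T.
  have := derivn_on_spline_cvg (ltnSn n) t0T; rewrite th orbT subnn => /(_ isT).
  move=> /(derivable_onP T_gt0 t0T)[dx ->]; split => //.
  rewrite spline0E; case: ifP => _.
    by rewrite xp mulVf// gt_eqF.
  by rewrite xq mulrN mulVf// gt_eqF.
- move=> i ilen; rewrite !derivn_on_spline ?lexx ?(ltW T_gt0)//.
  by rewrite subSn//; exact: spline_periodic.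
- by exists p, q; split => //; rewrite xp xq; lra.
Qed.

End spline.

(** The point s is 0 for odd n and the midpoint T / 4 of [0, T / 2] for even n;
there the chain takes the values given by the Bernoulli and the Euler
numbers. *)
Lemma favardK_euler_chain (R : realType) (n : nat) (T : R) :
  (1 <= n)%N -> 0 < T ->
  exists (P : nat -> {poly R}) (s : R),
    [/\ euler_chain (T / 2) P, 0 <= s <= T / 2, (P n).[s] != 0
      & `|(P n).[s]| = favardK R n * T ^+ n].
Proof.
move=> n_ge1 T_gt0; have T0 : T != 0 by rewrite gt_eqF.
have h0 : 0 < T / 2 by rewrite divr_gt0.
have := odd_double_half n; rewrite /favardK; case: ifP => _ nE.
- have hB : bernoulli_chain (appell (fun k => bernoulli_nb R k / k`!%:R)).
    apply: appell_bernoulli_chain; last exact: bernoulli_recurrence.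
    by have := bernoulli_recurrence R 0; rewrite big_ord1 fact0 !divr1.
  have chP := euler_chain_of_bernoulli T_gt0 hB.
  eexists; exists 0; split; first exact: chP.
  + by rewrite lexx ltW.
  + by rewrite -nE add1n; apply: (euler_chain_odd_neq0 n./2 h0 chP).
  (* P_n(0) = 2 T^n (C_{n+1}(1/2) - C_{n+1}(0)), which the duplication formula
     turns into 2 T^n (2 / 2^(n+1) - 2) B_{n+1} / (n+1)!. *)
  rewrite !(hornerZ, hornerD, hornerN) !horner_affine mulr0 !add0r.
  rewrite bernoulli_chain_half// horner_appell0.
  set b := bernoulli_nb R n.+1.
  rewrite [LHS](_ : _ = `|- ((2 ^+ n.+1 - 1) * b
      / (2 ^+ n.-1 * n.+1`!%:R) * T ^+ n)|); last first.
    congr (`|_|); rewrite -(prednK n_ge1) /= !exprS; field.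
    by rewrite expf_neq0// pnatr_eq0 -lt0n fact_gt0.
  rewrite normrN !normrM normfV !normrM (ger0_norm (ltW (exprn_gt0 n T_gt0))).
  rewrite (ger0_norm (_ : 0 <= 2 ^+ n.+1 - 1)) ?subr_ge0 ?exprn_ege1 ?ler1n//.
  by rewrite normrX !normr_nat.
- have chP := euler_chain_of_even_recurrence
    (c := fun k => euler_nb R k / k`!%:R) T_gt0 (@euler_recurrence R).
  eexists; exists (T / 4); split; first exact: chP.
  + by apply/andP; split; lra.
  + have := euler_chain_even_neq0 n./2 chP (t := T / 4).
    by rewrite -[n./2.*2]add0n nE; apply; apply/andP; split; lra.
  (* The midpoint T / 4 is sent to 0, where the chain takes the value E_n / n!. *)
  rewrite hornerZ horner_affine mulVf ?mulf_neq0 ?invr_eq0//.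
  rewrite subrr horner_appell0 normrM normrX !normf_div !normr_nat.
  rewrite (gtr0_norm T_gt0) expr_div_n; field.
  by rewrite expf_neq0// pnatr_eq0 -lt0n fact_gt0.
Qed.

Theorem mainTheorem3 (R : realType) (n : nat) (n_ge1 : (1 <= n)%N)
    (T : R) (T_gt0 : 0 < T) (L : R) (L_def : L = 1 / (favardK R n * T ^+ n)) :
  exists tau : R -> R,
    [/\ (forall t, 0 <= t <= T -> 0 <= tau t <= T),
        measurable_fun `[0, T]%classic tau &
        exists x : R -> R,
          [/\ AC_on 0 T n.-1 x,
              {ae @lebesgue_measure R, forall t, 0 <= t <= T ->
                 derivable_on 0 T (derivn_on 0 T n.-1 x) t /\
                 derivn_on 0 T n x t = L * x (tau t)},
              (forall i, (i < n)%N ->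
                 derivn_on 0 T i x 0 = derivn_on 0 T i x T) &
              exists s t, [/\ 0 <= s <= T, 0 <= t <= T & x s <> x t]]].
Proof.
have [P [s [chP s0h Ps0 PsE]]] := favardK_euler_chain n_ge1 T_gt0.
case: n n_ge1 L_def Ps0 PsE => // n _ L_def Ps0 PsE.
by rewrite L_def -PsE div1r; exact: spline_solution.
Qed.
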